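(* Let $p\ge 1$, let $f:[0,\infty)\to[0,\infty)$ be $p$-radical convex, and let $0<\alpha<\beta$. Then $$\int_\alpha^\beta\left(\frac1x\int_0^x f(t)\,dt\right)^p dx\le \left(\frac{1}{p+1}\right)^p\int_\alpha^\beta f(x)^p\,dx.$$ The inequality is sharp: the function $f(x)=x^p$ turns this inequality into an identity.
   Context: Let $p\ge 1$. A continuous function $f:[0,\infty)\to[0,\infty)$ with $f(0)=0$ is called $p$-radical convex if the function $x\mapsto f\left(x^{1/p}\right)$ is convex on $[0,\infty)$. *)

(* Defs.v *)
From mathcomp Require Import all_boot all_order all_algebra.
From mathcomp Require Import all_classical all_reals all_analysis.
Import numFieldNormedType.Exports.
Set Implicit Arguments.
Unset Strict Implicit.
Unset Printing Implicit Defensive.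
Import Order.TTheory GRing.Theory Num.Theory.
Local Open Scope classical_set_scope.
Local Open Scope ring_scope.

(* A function [0, +oo[ -> [0, +oo[ is represented by f : R -> R whose values
   outside [0, +oo[ are irrelevant: every clause looks at f on [0, +oo[ only. *)
Definition p_radical_convex (R : realType) (p : R) (f : R -> R) : Prop :=
  [/\ {within `[0, +oo[, continuous f},
      forall x, 0 <= x -> 0 <= f x,
      f 0 = 0 &
      convex_function (E := R^o) `[0, +oo[ (fun x : R => f (x `^ p^-1))].

(* Main.v *)
(** With g x = f (x^(1/p)) convex and g 0 = 0, the chord from the origin gives
    f t <= (t / x)^p f x for 0 <= t <= x; integrating in t over [0, x] bounds
    the mean of f over [0, x] by f x / (p + 1). The inequality therefore holds
    already pointwise under the outer integrals. *)
Require Import Defs.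
From mathcomp Require Import all_boot all_order all_algebra.
From mathcomp Require Import all_classical all_reals all_analysis.
From mathcomp Require Import ring.
Import numFieldNormedType.Exports.
Import Order.TTheory GRing.Theory Num.Theory.
Local Open Scope classical_set_scope.
Local Open Scope ring_scope.

Lemma powR_cvg_at_right0 (R : realType) (r : R) :
  0 < r -> x `^ r @[x --> 0^'+] --> (0 : R).
Proof.
move=> r0; apply/cvgrPdist_lt => e e0; near=> x.
have x0 : 0 < x by near: x; exact: nbhs_right_gt.
rewrite sub0r normrN ger0_norm ?powR_ge0//.
have -> : e = (e `^ r^-1) `^ r.
  by rewrite -powRrM mulVf ?gt_eqF// powRr1// ltW.
rewrite gt0_ltr_powR// ?nnegrE ?powR_ge0 ?ltW//.
by near: x; apply: nbhs_right_lt; rewrite powR_gt0.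
Unshelve. all: by end_near. Qed.

Lemma powR_continuous_gt0 (R : realType) (r x : R) :
  0 < x -> {for x, continuous (fun y : R => y `^ r)}.
Proof.
move=> x0; apply: differentiable_continuous; apply/derivable1_diffP.
by apply: derivable_powR; rewrite in_itv/= x0.
Qed.

Lemma powR_within_continuous (R : realType) (r : R) :
  0 < r -> {within `[0, +oo[, continuous (fun y : R => y `^ r)}.
Proof.
move=> r0; apply/continuous_within_itvcyP; split.
  by move=> x; rewrite in_itv/= andbT => x0; exact: powR_continuous_gt0.
by rewrite powR0 ?gt_eqF//; exact: powR_cvg_at_right0.
Qed.

Lemma within_continuous_itv (R : realType) (a b : R) (f : R -> R) : 0 <= a ->
  {within `[0, +oo[, continuous f} -> {within `[a, b], continuous f}.
Proof.
move=> a0; apply: continuous_subspaceW => x /=; rewrite !in_itv/= andbT.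
by move=> /andP[/(le_trans a0)].
Qed.

Lemma integral_powR (R : realType) (p x : R) : 0 < p -> 0 < x ->
  \int[@lebesgue_measure R]_(t in `[0, x]) (t `^ p) = (p + 1)^-1 * x `^ (p + 1).
Proof.
move=> p0 x0.
have p10 : 0 < p + 1 by rewrite addr_gt0.
have cF (y : R) : 0 < y ->
    is_derive y 1 (fun t : R => (p + 1)^-1 * t `^ (p + 1)) (y `^ p).
  move=> y0; have := is_deriveZ (p + 1)^-1 (is_derive1_powR (p + 1) y0).
  by rewrite addrK scalerA mulVf ?gt_eqF// scale1r.
rewrite /Rintegral (@continuous_FTC2 _ _
  (fun t : R => (p + 1)^-1 * t `^ (p + 1)))//=.
- by rewrite powR0 ?gt_eqF// mulr0 subr0.
- by apply: within_continuous_itv => //; exact: powR_within_continuous.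
- split=> [y| |]; first by rewrite in_itv/= => /andP[/cF].
  + apply: cvgM; first exact: cvg_cst.
    by rewrite powR0 ?gt_eqF//; exact: powR_cvg_at_right0.
  + apply: cvgM; first exact: cvg_cst.
    by apply: cvg_at_left_filter; exact: powR_continuous_gt0.
- by move=> y; rewrite in_itv/= derive1E => /andP[/cF ? _]; exact: derive_val.
Qed.

(** The integrand is measurable and bounded by the [p]-th power of the maximum of [f]. This avoids
    having to prove continuity of the power where [f] vanishes. *)
Lemma integrable_powR_comp (R : realType) (p a b : R) (f : R -> R) : 0 <= p ->
  {within `[a, b], continuous f} -> (forall x, x \in `[a, b] -> 0 <= f x) ->
  (@lebesgue_measure R).-integrable `[a, b] (EFin \o (fun x => f x `^ p)).
Proof.
move=> p0 cf f0.
have [ab|ba] := leP a b; last first.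
  by rewrite set_itv_ge -?leNgt ?bnd_simp -?ltNge//; exact: integrable_set0.
have [c cab fc] := EVT_max ab cf.
apply: measurable_bounded_integrable => //.
- by rewrite /= lebesgue_measure_itv/=; case: ifP; rewrite ?ltry.
- apply: (@measurableT_comp _ _ _ _ _ _ (fun y : R => y `^ p)) => //.
  exact: measurable_realfun.subspace_continuous_measurable_fun.
- exists (f c `^ p); split; first exact: num_real.
  move=> M cM x /= xab; rewrite ger0_norm ?powR_ge0//.
  apply: le_trans (ltW cM).
  by rewrite ge0_ler_powR// ?nnegrE ?f0// fc.
Qed.

(** Unfolds the abstract convex combinations of [R^o] into arithmetic and fixes the convention that
    the weight [t] falls on the first point. *)
Lemma convex_functionRE (R : realType) (D : set R) (g : R -> R) :
  convex_function (E := R^o) D g =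
  forall t : {i01 R}, {in D &, forall x y : R,
    g (t%:num * x + (1 - t%:num) * y) <= t%:num * g x + (1 - t%:num) * g y}.
Proof. by []. Qed.

Section radical_convex.
Variables (R : realType) (p : R) (f : R -> R).
Hypotheses (p0 : 0 < p) (pf : p_radical_convex p f).
Let mu := @lebesgue_measure R.

Lemma p_radical_convex_chord (t x : R) :
  0 <= t <= x -> 0 < x -> f t <= (t / x) `^ p * f x.
Proof.
have [_ _ f00] := pf; rewrite convex_functionRE => cvx.
move=> /andP[t0 tx] x0.
have s0 : 0 <= (t / x) `^ p by rewrite powR_ge0.
have tx0 : 0 <= t / x by rewrite divr_ge0// ltW.
have s1 : (t / x) `^ p <= 1.
  have <- : 1 `^ p = 1 by rewrite powR1.
  rewrite ge0_ler_powR ?nnegrE ?(ltW p0)//.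
  by rewrite ler_pdivrMr ?mul1r.
have powK y : 0 <= y -> (y `^ p) `^ p^-1 = y.
  by move=> y0; rewrite -powRrM mulfV ?gt_eqF// powRr1.
have := cvx (Itv01 s0 s1) (x `^ p) 0.
rewrite !inE/= !in_itv/= powR_ge0 lexx => /(_ erefl erefl).
rewrite mulr0 addr0 -powRM ?(ltW x0)// divfK ?gt_eqF//.
by rewrite !powK ?(ltW x0)// powR0 ?invr_neq0 ?gt_eqF// f00 mulr0 addr0.
Qed.

Lemma p_radical_convex_integrable (x : R) :
  mu.-integrable `[0, x] (EFin \o f).
Proof.
have [cf _ _ _] := pf.
by apply: continuous_compact_integrable;
  [exact: segment_compact | exact: within_continuous_itv].
Qed.

Lemma p_radical_convex_mean_ge0 (x : R) : 0 < x ->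
  0 <= x^-1 * \int[mu]_(t in `[0, x]) f t.
Proof.
have [_ f0 _ _] := pf.
move=> x0; rewrite mulr_ge0 ?invr_ge0 ?(ltW x0)//; apply: Rintegral_ge0 => t /=.
by rewrite in_itv/= => /andP[/f0].
Qed.

Lemma p_radical_convex_mean_le (x : R) : 0 < x ->
  x^-1 * \int[mu]_(t in `[0, x]) f t <= (p + 1)^-1 * f x.
Proof.
move=> x0.
have ip : mu.-integrable `[0, x] (EFin \o (fun t : R => t `^ p)).
  apply: continuous_compact_integrable; first exact: segment_compact.
  by apply: within_continuous_itv => //; exact: powR_within_continuous.
have xp0 : x `^ p != 0 by rewrite gt_eqF// powR_gt0.
have : \int[mu]_(t in `[0, x]) f t <=
    \int[mu]_(t in `[0, x]) (f x / x `^ p * t `^ p).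
  apply: le_Rintegral => //.
  - exact: p_radical_convex_integrable.
  - exact: (integrableZl _ (f x / x `^ p) ip).
  - move=> t /=; rewrite in_itv/= => /andP[t0 tx].
    apply: le_trans (@p_radical_convex_chord t x _ x0) _; first by rewrite t0.
    rewrite powRM ?invr_ge0 ?(ltW x0)// -powR_inv1 ?(ltW x0)// -!powRrM.
    by rewrite mulN1r powRN mulrC mulrA mulrAC.
rewrite RintegralZl// integral_powR// powRD; last first.
  by rewrite (gt_eqF x0) implybT.
rewrite powRr1 ?(ltW x0)// -ler_pdivlMl ?invr_gt0// invrK => h.
apply: le_trans h _; rewrite le_eqVlt; apply/orP; left; apply/eqP.
by field; rewrite xp0 gt_eqF ?addr_gt0.
Qed.

(** Away from 0 the factor [x^-1] is continuous, and the integral of an integrable function depends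
    continuously on its upper limit. This serves to make the [p]-th power of the mean integrable. *)
Lemma p_radical_convex_mean_continuous (a b : R) : 0 < a -> a <= b ->
  {within `[a, b], continuous (fun x => x^-1 * \int[mu]_(t in `[0, x]) f t)}.
Proof.
move=> a0 ab x; apply: continuousM.
  apply: continuous_in_subspaceT => y; rewrite inE/= in_itv/= => /andP[ay _].
  by apply: inv_continuous; rewrite gt_eqF// (lt_le_trans a0).
have b0 : 0 <= b by rewrite (le_trans _ ab)// ltW.
move: x; apply: continuous_subspaceW (parameterized_integral_continuous b0
  (p_radical_convex_integrable b)).
by apply: subset_itvr; rewrite bnd_simp ltW.
Qed.

End radical_convex.

(** Composing with the [p]-th root yields the identity on the half-line, for which convexity holds
    with equality. *)
Lemma p_radical_convex_powR (R : realType) (p : R) :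
  0 < p -> p_radical_convex p (fun x : R => x `^ p).
Proof.
move=> p0; split.
- exact: powR_within_continuous.
- by move=> x _; exact: powR_ge0.
- by rewrite powR0 ?gt_eqF.
- have powK (y : R) : 0 <= y -> (y `^ p^-1) `^ p = y.
    by move=> y0; rewrite -powRrM mulVf ?gt_eqF// powRr1.
  rewrite convex_functionRE => t x y; rewrite !inE/= !in_itv/= !andbT => x0 y0.
  by rewrite !powK// addr_ge0// mulr_ge0// subr_ge0.
Qed.

Theorem theorem3p1 (R : realType) (p : R) (hp : 1 <= p)
    (alpha beta : R) (halpha : 0 < alpha) (hbeta : alpha < beta) :
  let mu := @lebesgue_measure R in
  (forall f : R -> R, p_radical_convex p f ->
    \int[mu]_(x in `[alpha, beta])
      (x^-1 * \int[mu]_(t in `[0, x]) f t) `^ p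
    <= ((p + 1)^-1) `^ p * \int[mu]_(x in `[alpha, beta]) (f x `^ p)) /\
  (p_radical_convex p (fun x : R => x `^ p) /\
    \int[mu]_(x in `[alpha, beta])
      (x^-1 * \int[mu]_(t in `[0, x]) (t `^ p)) `^ p
    = ((p + 1)^-1) `^ p * \int[mu]_(x in `[alpha, beta]) ((x `^ p) `^ p)).
Proof.
move=> mu.
have p0 : 0 < p by rewrite (lt_le_trans ltr01).
have p10 : 0 <= (p + 1)^-1 by rewrite invr_ge0 addr_ge0// ltW.
have gt0 x : x \in `[alpha, beta] -> 0 < x.
  by rewrite in_itv/= => /andP[/(lt_le_trans halpha)].
have ifp f : p_radical_convex p f ->
    mu.-integrable `[alpha, beta] (EFin \o (fun x => f x `^ p)).
  move=> [cf f0 _ _]; apply: integrable_powR_comp; first exact: ltW.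
    by apply: within_continuous_itv => //; exact: ltW.
  by move=> x /gt0/ltW/f0.
split=> [f pf|]; last split; [|exact: p_radical_convex_powR|].
- have [_ f0 _ _] := pf.
  rewrite -RintegralZl//; last exact: ifp.
  apply: le_Rintegral => //.
  + apply: integrable_powR_comp; first exact: ltW.
      by apply: (p_radical_convex_mean_continuous _ _ _ pf) => //; exact: ltW.
    by move=> x /gt0; exact: (p_radical_convex_mean_ge0 _ _ _ pf).
  + exact: (integrableZl _ ((p + 1)^-1 `^ p) (ifp f pf)).
  + move=> x /= /gt0 x0; have fx0 := f0 _ (ltW x0).
    rewrite -powRM//.
    apply: ge0_ler_powR; rewrite ?nnegrE ?(ltW p0)//.
    * exact: (p_radical_convex_mean_ge0 _ _ _ pf).
    * by rewrite mulr_ge0.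
    * exact: p_radical_convex_mean_le.
- rewrite -RintegralZl//; last exact: ifp (p_radical_convex_powR _ _ p0).
  (* The integrands agree pointwise, because the mean of [t]^ p[over][0, x][is exactly]x
     [^ p / (p + 1)]. *)
  apply: eq_Rintegral => x; rewrite inE/= => /gt0 x0.
  rewrite integral_powR// -powRM ?powR_ge0//; congr (_ `^ _).
  rewrite powRD; last by rewrite (gt_eqF x0) implybT.
  by rewrite powRr1 ?(ltW x0)//; field; rewrite !gt_eqF ?addr_gt0.
Qed.
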